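(* Let $n$ be a positive integer and let $A=\{a_1,\dots,a_{|A|}\}\subset [n]$, with $a_1<a_2<\cdots<a_{|A|}$, be a dense Sidon set. Write $|A|=n^{1/2}-L'$ (with $L'$ real) and put $L=\max\{0,L'\}$. Then for every $1\le m\le |A|$, $$a_m = m\cdot n^{1/2} + \mathcal O\left(n^{7/8}\right) + \mathcal O\left(L^{1/2}\cdot n^{3/4}\right),$$ where the implied constants are absolute (independent of $n$, $A$ and $m$).
   Context: $[n]=\{1,2,\dots,n\}$. A set $A$ of positive integers is a Sidon set if the equation $a+b=c+d$ has no non-trivial solutions in $A$, i.e. $a,b,c,d\in A$ and $a+b=c+d$ imply $\{a,b\}=\{c,d\}$. A Sidon subset $A\subset[n]$ is called dense if $|A|=\max|S|$, the maximum being over all Sidon subsets $S$ of $[n]$. $X=Y+\mathcal O(E_1)+\mathcal O(E_2)$ means $|X-Y|\le C(E_1+E_2)$ for some constant $C$. *)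

(* Defs.v *)
From mathcomp Require Import all_boot all_order all_algebra.
From mathcomp Require Import finmap.
From mathcomp Require Import reals exp.

Set Implicit Arguments.
Unset Strict Implicit.
Unset Printing Implicit Defensive.

Local Open Scope fset_scope.

Definition interval1 (n : nat) : {fset nat} := [fset k in iota 1 n].

Lemma in_interval1 (n k : nat) : (k \in interval1 n) = (1 <= k <= n)%N.
Proof. by rewrite !inE /= mem_iota add1n ltnS. Qed.

(* The conclusion is equality of unordered pairs as sets, so x = y is allowed. *)
Definition sidon (A : {fset nat}) : Prop :=
  forall x y z t : nat, x \in A -> y \in A -> z \in A -> t \in A ->
    (x + y = z + t)%N -> [fset x; y] = [fset z; t].

Definition dense_sidon (n : nat) (A : {fset nat}) : Prop :=
  [/\ A `<=` interval1 n,
      sidon A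
    & forall S : {fset nat}, S `<=` interval1 n -> sidon S ->
        (#|` S| <= #|` A|)%N].

(* Indices start at 1, and only the values a 1, ..., a #|A| are constrained. *)
Definition increasing_enum (A : {fset nat}) (a : nat -> nat) : Prop :=
  (forall i j : nat, (1 <= i)%N -> (i < j)%N -> (j <= #|` A|)%N ->
     (a i < a j)%N) /\
  (forall x : nat,
     x \in A <-> exists i : nat, [/\ (1 <= i)%N, (i <= #|` A|)%N & a i = x]).

(* Main.v *)
Require Import Defs.
From mathcomp Require Import all_boot all_order all_algebra.
From mathcomp Require Import finmap.
From mathcomp Require Import reals exp.
From mathcomp Require Import zify ring lra.

Import Order.TTheory GRing.Theory Num.Theory.
Local Open Scope ring_scope.

(** A set A of k integers in [1, n] is uniformly distributed as soon as most
    windows [i - u + 1, i] of length u contain about the same number of its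
    elements. Let W i be that number. Summed over the N = n + u windows that
    can meet A, W has total k u ([sum_window]). Its second moment counts pairs
    of elements at distance d < u with weight u - d. In a Sidon set each
    difference d > 0 comes from at most one pair ([sidon_diff_inj]), so
    the second moment is at most k u + u ^ 2 ([sum_window_sqr]). When k is
    close to sqrt n this is close to (k u) ^ 2 / N, the least value that
    Cauchy--Schwarz permits. The variance of W is therefore small, at
    O(n^(1/4) + L) per window for u near n^(3/4) ([window_variance]).

    For x = a_m, the sum T of W i over i <= x counts each element of A up to x
    with weight u, except for those in the last window ([window_prefix]). These
    are O(sqrt u), again since their differences are distinct ([window_sqr]).
    Cauchy--Schwarz on the deviations of W over i <= x ([sqr_sum_le]) gives
    T = x k u / N + O(n^(9/8) + L^(1/2) n), hence
    m = x k / N + O(n^(3/8) + L^(1/2) n^(1/4)). Solving for x gives the theorem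
    ([position_of_prefix_count]). The choice u ~ n^(3/4) balances the term
    k u against the term u ^ 3 / n in the variance.

    A lower bound on k enters only through L. The upper bound on k that is
    needed when k > sqrt n is the Erdos--Turan bound, and it follows from the
    variance being nonnegative. *)

(** * Differences in a Sidon set *)

Lemma sidon_diff_inj (A : {fset nat}) (a b c d : nat) : sidon A ->
  a \in A -> b \in A -> c \in A -> d \in A ->
  (a < b)%N -> (c < d)%N -> (b - a = d - c)%N -> (a, b) = (c, d).
Proof.
move=> sA aA bA cA dA ab cd e.
have /fsetP E := sA a d c b aA dA cA bA ltac:(lia).
(* a + d = c + b, so {a, d} = {c, b}; a = b is excluded, hence a = c. *)
have := E a; rewrite !in_fset2 eqxx /= => /esym/orP[|] /eqP ac; last by lia.
by congr pair; lia.
Qed.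

(** The general weight f serves twice: f = 1 counts close pairs, and f d = u - d
    is the number of windows of length u containing both points of a pair at
    distance d. *)
Lemma sidon_sum_diff (A : {fset nat}) (u : nat) (f : nat -> nat) : sidon A ->
  (\sum_(a <- A) \sum_(b <- A | a < b < a + u) f (b - a)
     <= \sum_(1 <= d < u) f d)%N.
Proof.
move=> sA.
pose s := [seq (a, b) | a <- A, b <- [seq b <- A | a < b < a + u]]%N.
have sP p : (p \in s) -> [/\ p.1 \in A, p.2 \in A & p.1 < p.2 < p.1 + u]%N.
  by case/allpairsPdep => a [b] [aA]; rewrite mem_filter => /andP[? ?] ->.
have us : uniq s.
  apply: allpairs_uniq_dep => [|a aA|[a b] [c d] _ _ [-> ->] //]; first exact: fset_uniq.
  by rewrite filter_uniq ?fset_uniq.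
have ud : uniq [seq (p.2 - p.1)%N | p <- s].
  rewrite map_inj_in_uniq; first by apply: us.
  move=> [a b] [c d] /sP /= [aA bA ab] /sP /= [cA dA cd].
  by move=> e; apply: (@sidon_diff_inj A) => //; lia.
have -> : (\sum_(a <- A) \sum_(b <- A | a < b < a + u) f (b - a) =
    \sum_(d <- [seq p.2 - p.1 | p <- s]) f d)%N.
  rewrite big_map big_allpairs_dep; apply: eq_bigr => a _.
  by rewrite big_filter.
apply: (sub_le_big_seq leqnn (fun x y => leq_addr y x)) => d.
rewrite !count_uniq_mem ?iota_uniq //.
case: (boolP (d \in map _ _)) => //= /mapP[p /sP[_ _ ?] ->].
have -> : (p.2 - p.1 \in index_iota 1 u)%N by rewrite mem_index_iota; lia.
by [].
Qed.

Lemma sqr_sum_nat (s : seq nat) (F : nat -> nat) : uniq s ->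
  ((\sum_(a <- s) F a) ^ 2 =
    \sum_(a <- s) F a ^ 2 + 2 * \sum_(a <- s) \sum_(b <- s | a < b) F a * F b)%N.
Proof.
move=> us; rewrite -mulnn big_distrlr /= mul2n -addnn.
rewrite [X in (_ + (_ + X))%N](exchange_big_dep xpredT) //= -!big_split /=.
apply: eq_big_seq => a aS.
rewrite (bigID (fun b => a < b)%N) /= addnC (bigID (pred1 a)) /=.
rewrite big_mkcondl -big_filter filter_pred1_uniq // big_seq1 ltnn /= -mulnn.
rewrite -addnA; congr addn; rewrite addnC; congr addn.
by apply: eq_big => [b|b _]; [lia|rewrite mulnC].
Qed.

(** Applied both to the points of one window and to all of A. *)
Lemma sidon_sqr_count (A : {fset nat}) (u : nat) (F : nat -> bool) : sidon A ->
  (forall a b, a \in A -> b \in A -> F a -> F b -> b < a + u)%N ->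
  ((\sum_(a <- A) F a) ^ 2 <= \sum_(a <- A) F a + 2 * u)%N.
Proof.
move=> sA Fu; rewrite sqr_sum_nat ?fset_uniq //; apply: leq_add.
  by apply: leq_sum => a _; case: (F a).
rewrite leq_mul2l /=; apply: leq_trans (_ : \sum_(1 <= d < u) 1 <= u)%N; last first.
  by rewrite sum_nat_const_nat; lia.
apply: leq_trans (sidon_sum_diff A u (fun=> 1%N) sA).
rewrite big_seq [leqRHS]big_seq; apply: leq_sum => a aA.
rewrite big_seq_cond [X in (X <= _)%N]big_mkcond.
rewrite [leqRHS]big_seq_cond [leqRHS]big_mkcond /=.
apply: leq_sum => b _; case bA: (b \in A) => //=.
rewrite mulnb; case: (boolP (F a && F b)) => [/andP[Fa Fb]|_]; last first.
  by case: ifP.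
by have ab := Fu a b aA bA Fa Fb; rewrite ab andbT.
Qed.

Lemma sidon_card_sqr (A : {fset nat}) (n : nat) : sidon A ->
  (A `<=` interval1 n)%fset -> (#|` A|%fset ^ 2 <= #|` A|%fset + 2 * n)%N.
Proof.
move=> sA /fsubsetP An; rewrite -sum1_size.
apply: (@sidon_sqr_count A n (fun=> true)) => // a b /An + /An.
by rewrite !in_interval1; lia.
Qed.

(** * Moments of window counts *)

Lemma sum_itv (b c p : nat) : (\sum_(i < p) (b <= i < c) = minn c p - b)%N.
Proof.
elim: p => [|p IH]; first by rewrite big_ord0 minn0.
by rewrite big_ord_recr /= IH; lia.
Qed.

Definition window (A : {fset nat}) (u i : nat) : nat :=
  (\sum_(a <- A) (a <= i < a + u))%N.

Lemma sum_window (A : {fset nat}) (u N : nat) :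
  (forall a, a \in A -> a + u <= N)%N ->
  (\sum_(i < N) window A u i = #|` A|%fset * u)%N.
Proof.
move=> AN; rewrite exchange_big /= -sum1_size big_distrl /=.
by apply: eq_big_seq => a /AN ?; rewrite sum_itv; lia.
Qed.

Lemma window_sqr (A : {fset nat}) (u x : nat) : sidon A ->
  (window A u x ^ 2 <= window A u x + 2 * u)%N.
Proof. by move=> sA; apply: sidon_sqr_count => // a b _ _; lia. Qed.

(** The off-diagonal pairs contribute twice the sum of u - d over 0 < d < u,
    which is u ^ 2 - u. *)
Lemma sum_window_sqr (A : {fset nat}) (u N : nat) : sidon A ->
  (forall a, a \in A -> a + u <= N)%N ->
  (\sum_(i < N) window A u i ^ 2 <= #|` A|%fset * u + u ^ 2)%N.
Proof.
move=> sA AN.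
under eq_bigr => i _ do rewrite sqr_sum_nat ?fset_uniq //.
rewrite big_split /=; apply: leq_add.
  rewrite -(sum_window _ _ _ AN); apply: eq_leq; apply: eq_bigr => i _.
  by apply: eq_bigr => a _; case: (_ <= _ < _)%N.
rewrite -big_distrr /= exchange_big /=.
have -> : (u ^ 2 = u + 2 * \sum_(1 <= d < u) (u - d))%N.
  case: u {AN} => [|u]; first by rewrite big_geq.
  rewrite big_add1 big_nat_rev /= add0n.
  rewrite (eq_big_nat _ _ (F2 := fun i => i.+1)); last by move=> i; lia.
  elim: u => [|u IH]; first by rewrite big_geq.
  by rewrite big_nat_recr //=; nia.
apply: leq_trans (leq_addl _ _); rewrite leq_mul2l /=.
apply: leq_trans (sidon_sum_diff A u (fun d => u - d)%N sA).
rewrite big_seq [leqRHS]big_seq; apply: leq_sum => a aA.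
rewrite exchange_big /= [leqLHS]big_mkcond [leqRHS]big_mkcond /=.
apply: leq_sum => b _; case: ltnP => //= ab.
rewrite (eq_bigr (fun i : 'I_N => nat_of_bool (b <= i < a + u)%N)); last first.
  by move=> i _; lia.
by rewrite sum_itv; case: ifP; lia.
Qed.

(** A point a <= x lies in u windows altogether, and they all end by x unless
    a is in the window ending at x itself. *)
Lemma window_prefix (A : {fset nat}) (u x : nat) :
  (\sum_(i < x.+1) window A u i <= u * \sum_(a <- A) (a <= x)
     <= \sum_(i < x.+1) window A u i + u * window A u x)%N.
Proof.
rewrite /window exchange_big /= !big_distrr /= -big_split /=.
apply/andP; split; apply: leq_sum => a _; rewrite sum_itv;
  by case: (leqP a x) => ?; case: (ltnP x (a + u)) => ?; rewrite ?muln0 ?muln1 ?andbF; lia.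
Qed.

Lemma count_le_enum (A : {fset nat}) (a : nat -> nat) (m : nat) :
  increasing_enum A a -> (1 <= m)%N -> (m <= #|` A|%fset)%N ->
  (\sum_(x <- A) (x <= a m) = m)%N.
Proof.
move=> [inc mem] m1 mk.
have pA : perm_eq A [seq a i | i <- iota 1 #|` A|%fset].
  apply: uniq_perm; first exact: fset_uniq.
    rewrite map_inj_in_uniq ?iota_uniq // => i j; rewrite !mem_iota => hi hj e.
    by case: (ltngtP i j) => // ij; [have := inc i j ltac:(lia) ij ltac:(lia)
                                    |have := inc j i ltac:(lia) ij ltac:(lia)]; lia.
  move=> x; apply/idP/mapP => [/mem[i [? ? <-]]|[i]].
    by exists i => //; rewrite mem_iota; lia.
  by rewrite mem_iota => ? ->; apply/mem; exists i; split => //; lia.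
rewrite (perm_big _ pA) big_map.
rewrite (eq_big_seq (fun i => nat_of_bool (i <= m)%N)); last first.
  move=> i; rewrite mem_iota => hi; congr nat_of_bool.
  case: (ltngtP i m) => [im|im|->]; last by lia.
  - by have := inc i m ltac:(lia) im ltac:(lia); lia.
  - by have := inc m i ltac:(lia) im ltac:(lia); lia.
have -> : iota 1 #|` A|%fset = index_iota 1 #|` A|%fset.+1.
  by rewrite /index_iota subSS subn0.
by rewrite big_add1 big_mkord (sum_itv 0 m) subn0; apply/minn_idPl.
Qed.

(** Cauchy--Schwarz against the constant sequence: the sum of the squares
    (p v_i - S) ^ 2 over i < p is p (p sum v_i ^ 2 - S ^ 2). *)
Lemma sqr_sum_le (R : realFieldType) (N p : nat) (v : nat -> R) :
  (p <= N)%N ->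
  (\sum_(i < p) v i) ^+ 2 <= p%:R * \sum_(i < N) v i ^+ 2.
Proof.
move=> pN.
case: p pN => [|p] pN; first by rewrite big_ord0 expr0n mul0r.
set S := \sum_(i < p.+1) v i; set P : R := p.+1%:R.
have P0 : 0 < P by rewrite ltr0n.
have H : 0 <= \sum_(i < p.+1) (P * v i - S) ^+ 2.
  by apply: sumr_ge0 => i _; apply: sqr_ge0.
have E : \sum_(i < p.+1) (P * v i - S) ^+ 2 =
   P * (P * \sum_(i < p.+1) v i ^+ 2 - S ^+ 2).
  rewrite (eq_bigr (fun i : 'I_p.+1 =>
     P ^+ 2 * v i ^+ 2 + (- (2 * P * S) * v i + S ^+ 2))); last by move=> i _; ring.
  by rewrite !big_split /= -!big_distrr /= sumr_const card_ord -/S -mulr_natl -/P; ring.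
move: H; rewrite E pmulr_rge0 // subr_ge0 => /le_trans; apply.
rewrite ler_pM2l // (big_ord_widen _ (fun i => v i ^+ 2) pN).
by rewrite [leRHS](bigID (fun i : 'I_N => i < p.+1)%N) /= lerDl sumr_ge0 // => i _; apply: sqr_ge0.
Qed.

(** The left-hand side is N ^ 3 times the variance of the window counts about their mean
    k u / N; the factor N keeps the mean out of denominators. Expanding the
    square leaves only the first two moments. *)
Lemma window_variance (R : realFieldType) (A : {fset nat}) (u N : nat) :
  sidon A -> (forall a, a \in A -> a + u <= N)%N ->
  \sum_(i < N) (N%:R * (window A u i)%:R - (#|` A|%fset * u)%:R) ^+ 2 <=
    N%:R * (N%:R * (#|` A|%fset * u + u ^ 2)%:R - (#|` A|%fset * u)%:R ^+ 2)
      :> R.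
Proof.
move=> sA AN; set k := #|` A|%fset.
rewrite (eq_bigr (fun i : 'I_N => N%:R ^+ 2 * (window A u i)%:R ^+ 2
   + (- (2 * N%:R * (k * u)%:R) * (window A u i)%:R + (k * u)%:R ^+ 2)));
  last by move=> i _; ring.
rewrite !big_split /= -!big_distrr /= sumr_const card_ord -natr_sum.
rewrite (sum_window A u N AN) -/k -mulr_natl.
have := sum_window_sqr A u N sA AN; rewrite -(ler_nat R) natr_sum.
under eq_bigr do rewrite natrX.
have : 0 <= N%:R ^+ 2 :> R by rewrite sqr_ge0.
set W := \sum_(_ < _) _; nra.
Qed.

(** * Inverting the counting estimate *)

(** With q = n ^ (1/8) and l = L ^ (1/2) every quantity is bounded by monomials
    in q and l: k = O(q^4), u ~ q^6, N ~ q^8 and w = O(q^3) for the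
    window count at x. Let Z be the variance factor in the last hypothesis; then
    Z = O(q^18 + q^16 l^2), because k^2 >= q^8 - 2 q^4 l^2. Hence N T differs
    from (x + 1) k u by O(q^17 + q^16 l), and N (u m - T) <= N u w = O(q^17) is
    no larger. Dividing by u gives N m = (x + 1) k + O(q^11 + q^10 l), in which
    N may be replaced by q^8 and k by q^4; dividing by q^4 then gives the
    claim. *)
Lemma position_of_prefix_count (R : realFieldType) (q u k m x L' l T w : R) :
  1 <= q -> q ^+ 6 <= u -> u <= 2 * q ^+ 6 ->
  k = q ^+ 4 - L' -> 0 <= l -> l ^+ 2 = Num.max 0 L' ->
  0 <= m -> m <= k -> 1 <= x -> x <= q ^+ 8 ->
  k ^+ 2 <= k + 2 * q ^+ 8 ->
  T <= u * m -> u * m <= T + u * w -> 0 <= w -> w ^+ 2 <= w + 2 * u ->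
  (k * u) ^+ 2 <= (q ^+ 8 + u) * (k * u + u ^+ 2) ->
  ((q ^+ 8 + u) * T - (x + 1) * (k * u)) ^+ 2
    <= (x + 1) * (q ^+ 8 + u) * ((q ^+ 8 + u) * (k * u + u ^+ 2) - (k * u) ^+ 2) ->
  `|x - m * q ^+ 4| <= 50 * (q ^+ 7 + l * q ^+ 6).
Proof.
move=> q1 uge ule kE l0 lE m0 mk x1 xle ksq Tle Tge w0 wsq Zge0 Vle.
have q0 : 0 < q by lra.
have q0w := ltW q0.
have qm i : 0 <= q ^+ i by rewrite exprn_ge0 //; lra.
have qle i j : (i <= j)%N -> q ^+ i <= q ^+ j by move=> ij; apply: ler_weXn2l.
have qD i j : q ^+ (i + j) = q ^+ i * q ^+ j by rewrite exprD.
have k0 : 0 <= k by lra.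
have l2L : L' <= l ^+ 2 by rewrite lE le_max lexx orbT.
have u0 : 0 < u by apply: lt_le_trans uge; rewrite exprn_gt0.
(* k and w both satisfy y (y - 1) <= 2 B, which bounds y by O(sqrt B). *)
have k_le : k <= 2 * q ^+ 4.
  have := qD 4%N 4%N; have := qle 0%N 4%N isT; rewrite expr0 => h e.
  by rewrite leNgt; apply/negP => hk; move: ksq; rewrite e; nra.
have w_le : w <= 3 * q ^+ 3.
  have := qD 3%N 3%N; have := qle 0%N 3%N isT; rewrite expr0 => h e.
  by rewrite leNgt; apply/negP => hk; move: wsq ule; rewrite e; nra.
set N := q ^+ 8 + u in Zge0 Vle *.
have Nge : q ^+ 8 <= N by rewrite /N; lra.
have Nle : N <= 3 * q ^+ 8 by have := qle 6%N 8%N isT; rewrite /N; lra.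
have N0 : 0 < N by apply: lt_le_trans Nge; rewrite exprn_gt0.
set Z := N * (k * u + u ^+ 2) - (k * u) ^+ 2 in Vle.
have Z0 : 0 <= Z by rewrite /Z subr_ge0.
have ku : k * u <= 4 * q ^+ 10.
  have -> : 4 * q ^+ 10 = (2 * q ^+ 4) * (2 * q ^+ 6) by rewrite (qD 4%N 6%N); ring.
  by apply: ler_pM => //; lra.
have ku0 : 0 <= k * u by rewrite mulr_ge0 //; lra.
have Z_le : Z <= 20 * q ^+ 18 + 8 * q ^+ 16 * l ^+ 2.
  (* The only term that L' can make large is u ^ 2 (q ^ 8 - k ^ 2). *)
  have -> : Z = N * (k * u) + u * u ^+ 2 + u ^+ 2 * (q ^+ 8 - k ^+ 2) by rewrite /Z /N; ring.
  have u2 : u ^+ 2 <= 4 * q ^+ 12.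
    have -> : 4 * q ^+ 12 = (2 * q ^+ 6) ^+ 2 by rewrite (qD 6%N 6%N); ring.
    by rewrite ler_sqr ?nnegrE //; lra.
  have h1 : N * (k * u) <= (3 * q ^+ 8) * (4 * q ^+ 10) by apply: ler_pM => //; lra.
  have h2 : u * u ^+ 2 <= (2 * q ^+ 6) * (4 * q ^+ 12) by apply: ler_pM => //; rewrite ?sqr_ge0 //; lra.
  have h3 : u ^+ 2 * (q ^+ 8 - k ^+ 2) <= (4 * q ^+ 12) * (2 * q ^+ 4 * l ^+ 2).
    have hk : q ^+ 8 - k ^+ 2 <= 2 * q ^+ 4 * l ^+ 2.
      rewrite kE (qD 4%N 4%N); have := qm 4%N; have := sqr_ge0 L'; nra.
    apply: le_trans (_ : u ^+ 2 * (2 * q ^+ 4 * l ^+ 2) <= _).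
      by rewrite ler_wpM2l // sqr_ge0.
    by rewrite ler_wpM2r // !mulr_ge0 ?sqr_ge0.
  have -> : 20 * q ^+ 18 + 8 * q ^+ 16 * l ^+ 2 =
     3 * q ^+ 8 * (4 * q ^+ 10) + 2 * q ^+ 6 * (4 * q ^+ 12) +
     (4 * q ^+ 12) * (2 * q ^+ 4 * l ^+ 2) by ring.
  lra.
have D_le : `|N * T - (x + 1) * (k * u)| <= 11 * (q ^+ 17 + q ^+ 16 * l).
  have r0 : 0 <= 11 * (q ^+ 17 + q ^+ 16 * l).
    by rewrite mulr_ge0 // addr_ge0 // mulr_ge0.
  rewrite -ler_sqr ?nnegrE // real_normK ?num_real //; apply: le_trans Vle _.
  have h : (x + 1) * N <= (2 * q ^+ 8) * (3 * q ^+ 8).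
    by apply: ler_pM => //; have := qle 0%N 8%N isT; rewrite expr0; lra.
  have h' : (x + 1) * N * Z <= (2 * q ^+ 8) * (3 * q ^+ 8) * (20 * q ^+ 18 + 8 * q ^+ 16 * l ^+ 2).
    by apply: ler_pM => //; rewrite mulr_ge0 //; lra.
  apply: le_trans h' _.
  rewrite -subr_ge0.
  have -> : (11 * (q ^+ 17 + q ^+ 16 * l)) ^+ 2 -
     2 * q ^+ 8 * (3 * q ^+ 8) * (20 * q ^+ 18 + 8 * q ^+ 16 * l ^+ 2)
     = q ^+ 34 + 242 * q ^+ 33 * l + 73 * (q ^+ 16 * l) ^+ 2 by ring.
  by rewrite !addr_ge0 ?mulr_ge0 ?sqr_ge0.
have E_le : `|N * m - (x + 1) * k| <= 29 * (q ^+ 11 + q ^+ 10 * l).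
  have hw : N * (u * w) <= 18 * q ^+ 17.
    have -> : 18 * q ^+ 17 = (3 * q ^+ 8) * ((2 * q ^+ 6) * (3 * q ^+ 3)) by ring.
    by rewrite !ler_pM ?mulr_ge0 //; lra.
  have hT1 : N * T <= N * (u * m) by rewrite ler_pM2l.
  have hT2 : N * (u * m) <= N * T + N * (u * w) by rewrite -mulrDr ler_pM2l.
  have ql16 : 0 <= q ^+ 16 * l by rewrite mulr_ge0.
  have hu : `|u * (N * m - (x + 1) * k)| <= 29 * (q ^+ 17 + q ^+ 16 * l).
    move: D_le; rewrite !ler_norml => /andP[d1 d2]; apply/andP.
    have -> : u * (N * m - (x + 1) * k) = N * (u * m) - (x + 1) * (k * u) by ring.
    by split; lra.
  have h6 : 0 < q ^+ 6 by rewrite exprn_gt0.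
  rewrite -(ler_pM2l h6).
  have -> : q ^+ 6 * (29 * (q ^+ 11 + q ^+ 10 * l)) = 29 * (q ^+ 17 + q ^+ 16 * l) by ring.
  apply: le_trans hu; rewrite normrM gtr0_norm //.
  by rewrite ler_wpM2r.
have ql10 : 0 <= q ^+ 10 * l by rewrite mulr_ge0.
have xL : `|x * L'| <= 4 * q ^+ 10 + q ^+ 10 * l.
  have x0 : 0 <= x by lra.
  rewrite normrM (ger0_norm x0).
  (* For L' <= 0 the bound on |L'| is an upper bound on k: Z >= 0 yields
     k ^ 2 <= q ^ 8 + 8 q ^ 6, so q ^ 4 |L'| <= 4 q ^ 6. For L' > 0, k >= 0
     gives l <= q ^ 2. *)
  have [Ln|Lp] := leP L' 0.
    have k4 : q ^+ 4 <= k by lra.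
    have hL : k ^+ 2 <= q ^+ 8 + 8 * q ^+ 6.
      have h : k ^+ 2 * u <= N * (k + u).
        rewrite -(ler_pM2r u0); apply: le_trans (_ : N * (k * u + u ^+ 2) <= _).
          by apply: le_trans Zge0; rewrite le_eqVlt; apply/orP; left; apply/eqP; ring.
        by rewrite le_eqVlt; apply/orP; left; apply/eqP; ring.
      have k2u : q ^+ 2 * k <= 2 * u.
        by apply: le_trans (_ : q ^+ 2 * (2 * q ^+ 4) <= _);
           [rewrite ler_wpM2l|have := qD 2%N 4%N; lra].
      have h8 : q ^+ 8 * k <= 2 * q ^+ 6 * u.
        have -> : q ^+ 8 * k = q ^+ 6 * (q ^+ 2 * k) by ring.
        have -> : 2 * q ^+ 6 * u = q ^+ 6 * (2 * u) by ring.
        by rewrite ler_wpM2l.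
      have h9 : u * k <= 4 * q ^+ 6 * u.
        have -> : u * k = k * u by ring.
        rewrite ler_pM2r //; have := qle 4%N 6%N isT; have := qm 6%N; lra.
      have h10 : u * u <= 2 * q ^+ 6 * u by rewrite ler_pM2r.
      rewrite -(ler_pM2r u0); apply: le_trans h _; rewrite /N.
      lra.
    have hL' : q ^+ 4 * (- L') <= 4 * q ^+ 6.
      move: hL; rewrite kE (qD 4%N 4%N); have := sqr_ge0 L'; lra.
    rewrite ler0_norm //.
    have : x * - L' <= q ^+ 8 * - L' by rewrite ler_wpM2r //; lra.
    have : q ^+ 4 * (q ^+ 4 * (- L')) <= q ^+ 4 * (4 * q ^+ 6) by rewrite ler_wpM2l.
    by rewrite mulrA -qD => h h'; have := qD 4%N 6%N; lra.
  have lL : l ^+ 2 = L' by rewrite lE max_r // ltW.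
  have lq : l <= q ^+ 2.
    by rewrite -ler_sqr ?nnegrE // lL -exprM; lra.
  rewrite gtr0_norm // -lL.
  have : x * l ^+ 2 <= q ^+ 8 * l ^+ 2 by rewrite ler_wpM2r // sqr_ge0.
  have : q ^+ 8 * l * l <= q ^+ 8 * l * q ^+ 2 by rewrite ler_wpM2l // mulr_ge0.
  have -> : q ^+ 8 * l * q ^+ 2 = q ^+ 10 * l by ring.
  by have := qm 10%N; lra.
have mu : m * u <= 4 * q ^+ 10 by apply: le_trans ku; rewrite ler_pM2r.
have mu0 : 0 <= m * u by rewrite mulr_ge0 //; lra.
have q4 : 0 < q ^+ 4 by rewrite exprn_gt0.
rewrite -(ler_pM2l q4).
have -> : q ^+ 4 * `|x - m * q ^+ 4| = `|q ^+ 4 * x - q ^+ 8 * m|.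
  by rewrite -{1}[q ^+ 4]gtr0_norm // -normrM; congr `|_|; ring.
have -> : q ^+ 4 * (50 * (q ^+ 7 + l * q ^+ 6)) = 50 * (q ^+ 11 + q ^+ 10 * l) by ring.
have q1011 := qle 10%N 11%N isT; have q411 := qle 4%N 11%N isT.
move: E_le xL; rewrite !ler_norml kE /N => /andP[e1 e2] /andP[f1 f2].
have k4 := qm 4%N; have := qm 11%N.
by move: k_le k0; rewrite kE => ? ? ?; apply/andP; split; lra.
Qed.

Theorem theorem3 (R : realType) :
  exists C : R,
    forall (n : nat) (A : {fset nat}) (a : nat -> nat) (L' L : R),
      (0 < n)%N ->
      dense_sidon n A ->
      increasing_enum A a ->
      (#|` A|%fset)%:R = n%:R `^ (1 / 2) - L' ->
      L = Num.max 0 L' ->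
      forall m : nat, (1 <= m)%N -> (m <= #|` A|%fset)%N ->
        `| (a m)%:R - m%:R * n%:R `^ (1 / 2) |
          <= C * (n%:R `^ (7 / 8) + L `^ (1 / 2) * n%:R `^ (3 / 4)).
Proof.
(* The estimates add up to less than 50; the constant is not optimized. *)
exists 50 => n A a L' L n0 [An sA _] inc kE LE m m1 mk.
pose q : R := n%:R `^ (1 / 8).
have qX i : q ^+ i = n%:R `^ (1 / 8 * i%:R) by rewrite powRrM powR_mulrn // powR_ge0.
have q8 : q ^+ 8 = n%:R by rewrite qX (_ : 1 / 8 * 8 = 1) ?powRr1 //; lra.
have q4 : n%:R `^ (1 / 2) = q ^+ 4 by rewrite qX; congr (_ `^ _); lra.
have q7 : n%:R `^ (7 / 8) = q ^+ 7 by rewrite qX; congr (_ `^ _); lra.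
have q6 : n%:R `^ (3 / 4) = q ^+ 6 by rewrite qX; congr (_ `^ _); lra.
have q0 : 0 <= q by rewrite powR_ge0.
have q1 : 1 <= q by rewrite -(ler_pXn2r (n := 8)) ?nnegrE // expr1n q8 ler1n.
have L0 : 0 <= L by rewrite LE le_max lexx.
rewrite q4 in kE *; rewrite q7 q6.
pose u := (Num.trunc (q ^+ 6)).+1.
have [ugt ule] : q ^+ 6 <= u%:R /\ u%:R <= 2 * q ^+ 6.
  have h6 : 1 <= q ^+ 6 by rewrite exprn_ege1.
  have /andP[h1 h2] := truncn_itv (exprn_ge0 6 q0).
  by split; [exact: ltW|rewrite /u -natr1; lra].
set x := a m.
have xA : x \in A by apply/inc.2; exists m.
have inA b : b \in A -> (1 <= b <= n)%N.
  by move/fsubsetP: An => /[apply]; rewrite in_interval1.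
have AN b : b \in A -> (b + u <= n + u)%N by move/inA; lia.
have xn := inA _ xA.
have pN : (x.+1 <= n + u)%N by rewrite /u; lia.
have /andP[T1 T2] := window_prefix A u x.
rewrite (count_le_enum _ _ _ inc m1 mk) in T1 T2.
set T := (\sum_(i < x.+1) _)%N in T1 T2.
set k := #|` A|%fset in kE mk.
pose N := (n + u)%N.
have NR : N%:R = q ^+ 8 + u%:R :> R by rewrite natrD q8.
pose v i : R := N%:R * (window A u i)%:R - (k * u)%:R.
have sv : \sum_(i < x.+1) v i = N%:R * T%:R - x.+1%:R * (k * u)%:R.
  rewrite /v sumrB -big_distrr /= natr_sum sumr_const card_ord.
  by rewrite -[_ *+ x.+1]mulr_natl.
have sv2 := window_variance R A u N sA AN.
rewrite -/k in sv2.
have V0 : 0 <= \sum_(i < N) v i ^+ 2 by apply: sumr_ge0 => i _; exact: sqr_ge0.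
have CS := sqr_sum_le _ N x.+1 v pN.
have N0 : 0 < N%:R :> R by rewrite ltr0n /N; lia.
have l2 : (L `^ (1 / 2)) ^+ 2 = L.
  by rewrite -powR_mulrn ?powR_ge0 // -powRrM (_ : 1 / 2 * 2 = 1) ?powRr1 //; lra.
apply: (position_of_prefix_count R q u%:R k%:R m%:R x%:R L' (L `^ (1 / 2)) T%:R (window A u x)%:R) => //.
- by rewrite powR_ge0.
- by rewrite l2.
- by rewrite ler_nat.
- by rewrite ler1n; lia.
- by rewrite q8 ler_nat; lia.
- by rewrite q8 -natrX -natrM -natrD ler_nat sidon_card_sqr.
- by rewrite -natrM ler_nat.
- by rewrite -!natrM -natrD ler_nat.
- by rewrite -natrX -natrM -natrD ler_nat window_sqr.
- by rewrite -NR -[in leRHS]natrX -natrM -natrD -subr_ge0 -(pmulr_rge0 _ N0) (le_trans V0).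
- rewrite -NR -[u%:R ^+ 2]natrX -natrM -natrD natr1 -mulrA -sv.
  by apply: le_trans CS _; rewrite ler_wpM2l.
Qed.
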